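(* Let $(F|L,v)$ be a finite valued inertial extension. Assume that the chain of prime ideals of $\mathcal O_L$ is well-ordered by inclusion. Let $\eta\in\mathcal O_F$ be an element such that $F=L(\eta)$, the monic minimal polynomial $h(X)$ of $\eta$ over $L$ lies in $\mathcal O_L[X]$, and $\eta$ and $h'(\eta)$ are units in $\mathcal O_F$, and set $\mathfrak n:=\mathfrak m_F\cap\mathcal O_L[\eta]$. Then the following (equivalent) conditions are all satisfied: (i) $\mathcal O_F$ is a finitely generated $\mathcal O_L$-algebra; (ii) there exists a unit $u$ of $\mathcal O_F$ with $u\in\mathcal O_L[\eta]$ such that $\mathcal O_F=\mathcal O_L[\eta,1/u]$; (iii) there are elements $r,s\in\mathcal O_F$, henselian over $\mathcal O_L$, such that $\mathcal O_F=\mathcal O_L[\eta,r,s]$; (iv) there exists an element $u\in\mathcal O_L[\eta]\setminus\mathfrak n$ such that $u$ belongs to every prime ideal of $\mathcal O_L[\eta]$ not contained in $\mathfrak n$; (v) for every chain of prime ideals $(\mathfrak p_\lambda)_{\lambda\in\Lambda}$ of $\mathcal O_L[\eta]$, if $\mathfrak p_\lambda\not\subseteq\mathfrak n$ for every $\lambda\in\Lambda$, then $\bigcap_{\lambda\in\Lambda}\mathfrak p_\lambda\not\subseteq\mathfrak n$.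
   Context: A valued field extension $(F|L,v)$ is a field extension $F|L$ together with a (Krull) valuation $v$ on $F$ (arbitrary value group); its restriction to $L$ is again denoted $v$. $\mathcal O_F$ and $\mathfrak m_F$ are the valuation ring of $v$ on $F$ and its maximal ideal, and $\mathcal O_L=\mathcal O_F\cap L$. Given a valued field $(L,v)$ and an extension of $v$ to the separable-algebraic closure $L^{\mathrm{sep}}$ (again denoted $v$, with maximal ideal $\mathfrak m_v$), let $I(\mathcal O_L)$ be the integral closure of $\mathcal O_L$ in $L^{\mathrm{sep}}$; the absolute inertia field $L^i$ is the subfield of $L^{\mathrm{sep}}$ of elements fixed by $\{\sigma\in\mathrm{Gal}(L^{\mathrm{sep}}|L)\mid \forall x\in I(\mathcal O_L):\ x-\sigma(x)\in\mathfrak m_v\cap I(\mathcal O_L)\}$. A finite valued inertial extension is a valued field extension $(F|L,v)$ with $[F:L]<\infty$ and $F\subseteq L^i$, where $L^i$ is taken with respect to an extension to $L^{\mathrm{sep}}$ of the valuation $v$ of $F$. For an extension $A\subseteq B$ of commutative rings with unity, $b\in B$ is henselian over $A$ if there is $g(X)\in A[X]$ (not necessarily monic) with $g(b)=0$ and $g'(b)$ a unit of $B$; here $A=\mathcal O_L$, $B=\mathcal O_F$. A chain is a family totally ordered by inclusion. An empty intersection of ideals is the whole ring. *)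

(* Defs.v *)
From mathcomp Require Import all_boot all_order all_algebra all_field.
From mathcomp Require Import boolp classical_sets wochoice.

Set Implicit Arguments.
Unset Strict Implicit.
Unset Printing Implicit Defensive.

Import Order.TTheory GRing.Theory Num.Theory.

Local Open Scope classical_set_scope.
Local Open Scope ring_scope.

(* Krull valuations, written additively. A valuation is a map K^* ->> Gamma
   onto a totally ordered abelian group; its value at 0 (conventionally
   infinity) is junk and is never used. *)
Record valuation (K : fieldType) := Valuation {
  value_group : porderZmodType;
  valuation_fun :> K -> value_group;
  value_group_total : total (<=%R : rel value_group);
  value_group_leD : forall a b c : value_group, a <= b -> a + c <= b + c;
  valuation_surj : forall a, exists2 x, x != 0 & valuation_fun x = a;
  valuationM : forall x y, x != 0 -> y != 0 ->
    valuation_fun (x * y) = valuation_fun x + valuation_fun y;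
  valuationD : forall x y, x != 0 -> y != 0 -> x + y != 0 ->
    Num.min (valuation_fun x) (valuation_fun y) <= valuation_fun (x + y)
}.

Definition valuation_ring (K : fieldType) (v : valuation K) : set K :=
  [set x | x = 0 \/ 0 <= v x].

Definition valuation_ideal (K : fieldType) (v : valuation K) : set K :=
  [set x | x = 0 \/ 0 < v x].

(* The value group of v is identified with its image under an order embedding
   into the value group of w. *)
Definition extends_valuation (K M : fieldType) (j : {rmorphism K -> M})
    (v : valuation K) (w : valuation M) : Prop :=
  exists phi : {additive value_group v -> value_group w},
    {mono phi : a b / a <= b} /\ forall x, x != 0 -> w (j x) = phi (v x).

(* M, with the embedding i, is a separable-algebraic closure of L. *)
Definition separable_closure (L M : fieldType) (i : {rmorphism L -> M}) : Prop :=
  (forall x : M, exists2 p : {poly L},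
      separable_poly p & root (map_poly i p) x) /\
  (forall q : {poly M}, separable_poly q -> (1 < size q)%N ->
      exists x, root q x).

Section AbsoluteInertia.
Variables (L M : fieldType) (i : {rmorphism L -> M}) (w : valuation M).

Definition integral_closure : set M :=
  [set x | exists p : {poly L}, [/\ p \is monic,
     forall k, valuation_ring w (i p`_k) & root (map_poly i p) x]].

Definition inertia_group : set {rmorphism M -> M} :=
  [set s : {rmorphism M -> M} | [/\ bijective s, forall a, s (i a) = i a &
     forall x, integral_closure x ->
       (valuation_ideal w `&` integral_closure) (x - s x)]].

Definition absolute_inertia_field : set M :=
  [set x | forall s, inertia_group s -> s x = x].

End AbsoluteInertia.

(* L is embedded in M through F, so that F is an intermediate field. *)
Definition inertial (L : fieldType) (F : fieldExtType L) (v : valuation F)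
    : Prop :=
  exists (M : fieldType) (j : {rmorphism F -> M}) (w : valuation M),
    let i : {rmorphism L -> M} := j \o in_alg F in
    [/\ separable_closure i, extends_valuation j v w &
        forall x, absolute_inertia_field i w (j x)].

(* Subrings of a fixed commutative ring R are handled as sets. *)
Section Subrings.
Variable R : comNzRingType.
Implicit Types A B P X : set R.

(* A[X]: the subring of R generated by A and X. *)
Definition adjoin A X : set R :=
  smallest (fun S : set R => subring_closed (mem S)) (A `|` X).

Definition units_of B : set R := [set x | B x /\ exists2 y, B y & x * y = 1].

Definition prime_ideal A P : Prop :=
  [/\ P `<=` A,
      P 0 /\ (forall a x y, A a -> P x -> P y -> P (a * x + y)),
      ~ P 1 &
      forall x y, A x -> A y -> P (x * y) -> P x \/ P y].

Definition finitely_generated_algebra A B : Prop :=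
  exists s : seq R, B = adjoin A [set` s].

Definition henselian A B (b : R) : Prop :=
  B b /\ exists g : {poly R},
    [/\ forall k, A g`_k, g.[b] = 0 & units_of B g^`().[b]].

End Subrings.

(* The valuation ring of the restriction of v to L, as a subring of F. *)
Definition base_valuation_ring (L : fieldType) (F : fieldExtType L)
    (v : valuation F) : set F :=
  valuation_ring v `&` [set x | x \in 1%VS].

(* Main.v *)
Require Import Defs.
From HB Require Import structures.
From mathcomp Require Import all_boot all_order all_algebra all_field.
From mathcomp Require Import boolp classical_sets wochoice.
From mathcomp Require Import ring.

(**
Write A for the valuation ring of L, R for A[eta], and n for the centre of the
valuation on R. Let r_1, ..., r_d be the conjugates of eta.

- O_F = R_n: an element y of O_F is a quotient c / b of elements with integral
  conjugates, b being a unit; by Lagrange interpolation h'(eta) b and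
  h'(eta) c lie in R.
- Every antichain of primes of R has at most [F : L] elements. Since R is
  integral over A and Spec A is well-ordered, every prime not contained in n
  contains a minimal one; these are finitely many, and a product u of elements
  of each of them outside n gives (iv). If x is in R but not in n, then u lies
  in all primes above x, so x divides a power of u and O_F = R[1/u].
- Some multiple e of u in R is idempotent modulo the maximal ideal of A, and
  x = e eta is congruent, at each conjugate r_k, to 0 or to r_k. As eta and
  h'(eta) are units, the residue of x is a simple root of the reduced
  characteristic polynomial of x; hence 1/x is henselian, and R[1/x] = O_F, so
  that r = s = 1/x works in (iii).
*)

Set Implicit Arguments.
Unset Strict Implicit.
Unset Printing Implicit Defensive.

Import Order.TTheory GRing.Theory Num.Theory.

Local Open Scope classical_set_scope.
Local Open Scope ring_scope.

(** * Valuation rings *)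

Section ValuationRing.
Variables (K : fieldType) (v : valuation K).

Lemma valuation1 : v 1 = 0.
Proof.
have := valuationM v (oner_neq0 K) (oner_neq0 K); rewrite mulr1 => e.
by apply: (addrI (v 1)); rewrite addr0.
Qed.

(** A totally ordered group has no 2-torsion; with (-1)(-1) = 1 this yields v(-1) = 0. *)
Lemma valuation_double_eq0 (a : value_group v) : a + a = 0 -> a = 0.
Proof.
move=> aa0; apply/eqP; rewrite eq_le.
have [a0|a0] := orP (value_group_total a 0); have := value_group_leD a a0;
  by rewrite aa0 add0r a0 => ->.
Qed.

Lemma valuationN1 : v (- 1) = 0.
Proof.
apply: valuation_double_eq0; rewrite -valuationM ?oppr_eq0 ?oner_neq0 //.
by rewrite mulrNN mulr1 valuation1.
Qed.

Lemma valuationV x : x != 0 -> v x^-1 = - v x.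
Proof.
move=> x0; apply/eqP; rewrite -addr_eq0 -valuationM ?invr_eq0 //.
by rewrite mulVf ?valuation1.
Qed.

(** Boolean version of [valuation_ring], so that it can carry closure instances for the [rpred]
    lemmas; [videal] does the same for the maximal ideal. *)
Definition vring : {pred K} := fun x => `[< valuation_ring v x >].

Lemma vringP x : reflect (x = 0 \/ 0 <= v x) (x \in vring).
Proof. exact: asboolP. Qed.

Lemma vring_subring : subring_closed vring.
Proof.
have OM : {in vring &, forall x y, x * y \in vring}.
  move=> x y /vringP hx /vringP hy; apply/vringP.
  have [->|x0] := eqVneq x 0; first by rewrite mul0r; left.
  have [->|y0] := eqVneq y 0; first by rewrite mulr0; left.
  right; case: hx => [/eqP|hx]; first by rewrite (negPf x0).
  case: hy => [/eqP|hy]; first by rewrite (negPf y0).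
  rewrite valuationM //; apply: le_trans hy _.
  by have := value_group_leD (v y) hx; rewrite add0r.
have ON1 : -1 \in vring by apply/vringP; right; rewrite valuationN1.
split=> //; first by apply/vringP; right; rewrite valuation1.
move=> x y hx /(OM _ _ ON1); rewrite mulN1r.
move: (- y) hx => {}y /vringP hx /vringP hy'; apply/vringP.
have [->|x0] := eqVneq x 0; first by rewrite add0r.
have [->|y0] := eqVneq y 0; first by rewrite addr0.
have [->|xy0] := eqVneq (x + y) 0; first by left.
case: hx => [/eqP|hx]; first by rewrite (negPf x0).
case: hy' => [/eqP|hy']; first by rewrite (negPf y0).
right; apply: le_trans _ (valuationD v x0 y0 xy0).
by rewrite /Order.min; case: ifP.
Qed.

HB.instance Definition _ := GRing.isSubringClosed.Build K vring vring_subring.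

Lemma vring_total x : x != 0 -> x \in vring \/ x^-1 \in vring.
Proof.
move=> x0; have [h|h] := orP (value_group_total 0 (v x)).
  by left; apply/vringP; right.
right; apply/vringP; right; rewrite valuationV //.
by have := value_group_leD (- v x) h; rewrite subrr add0r.
Qed.

Definition videal : {pred K} := fun x => `[< valuation_ideal v x >].

Lemma videalP x : reflect (x = 0 \/ 0 < v x) (x \in videal).
Proof. exact: asboolP. Qed.

Lemma videal_vring x : x \in videal -> x \in vring.
Proof. by move/videalP=> [->|/ltW h]; apply/vringP; [left|right]. Qed.

Lemma videal0 : 0 \in videal. Proof. by apply/videalP; left. Qed.

Lemma vunitP x : x \in vring -> x \notin videal <-> x != 0 /\ x^-1 \in vring.
Proof.
move=> /vringP hx; split.
  have [->|x0] := eqVneq x 0; first by rewrite videal0.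
  case: hx => [/eqP|hx]; first by rewrite (negPf x0).
  move=> /videalP nx; split=> //; apply/vringP; right; rewrite valuationV //.
  suff -> : v x = 0 by rewrite oppr0.
  apply: contrapT => /eqP vx; apply: nx; right.
  by rewrite lt_neqAle hx eq_sym vx.
case=> x0 /vringP [/eqP|]; first by rewrite invr_eq0 (negPf x0).
rewrite valuationV // => hV; apply/videalP => -[/eqP|]; first by rewrite (negPf x0).
have := value_group_leD (v x) hV; rewrite add0r addNr => h /lt_le_trans /(_ h).
by rewrite ltxx.
Qed.

Lemma videalN1 : 1 \notin videal.
Proof. by apply/vunitP; rewrite ?rpred1 // invr1 oner_neq0 rpred1. Qed.

Lemma videalMl x y : x \in vring -> y \in videal -> x * y \in videal.
Proof.
move=> hx my; have hy := videal_vring my.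
apply/negPn/negP => /vunitP [|]; first exact: rpredM.
rewrite mulf_eq0 negb_or => /andP [x0 y0] h.
suff : y \notin videal by rewrite my.
apply/vunitP => //; split=> //.
suff -> : y^-1 = x * (x * y)^-1 by apply: rpredM.
by rewrite invfM mulVKf.
Qed.

Lemma videalMr x y : x \in videal -> y \in vring -> x * y \in videal.
Proof. by move=> hx hy; rewrite mulrC videalMl. Qed.

Lemma videalD x y : x \in videal -> y \in videal -> x + y \in videal.
Proof.
(* Of two nonzero elements one divides the other in the valuation ring, so the divisor can be
   factored out of the sum. *)
wlog : x y / x / y \in vring => [wl|] mx my.
  have [->|y0] := eqVneq y 0; first by rewrite addr0.
  have [->|x0] := eqVneq x 0; first by rewrite add0r.
  have [|h|] := @vring_total (x / y); first by rewrite mulf_neq0 ?invr_eq0.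
    exact: wl.
  by rewrite invfM invrK mulrC => h; rewrite addrC; apply: wl.
move=> my'; have [->|y0] := eqVneq y 0; first by rewrite addr0.
have -> : x + y = (x / y + 1) * y by rewrite mulrDl mul1r divfK.
by rewrite videalMl // rpredD ?rpred1.
Qed.

Lemma videal_zmod : zmod_closed videal.
Proof.
split=> [|x y mx my]; first exact: videal0.
by apply: videalD => //; rewrite -mulN1r videalMl // rpredN rpred1.
Qed.

HB.instance Definition _ := GRing.isZmodClosed.Build K videal videal_zmod.

Lemma vunitM x y : x \in vring -> y \in vring ->
  (x * y \notin videal) = (x \notin videal) && (y \notin videal).
Proof.
move=> hx hy; apply/idP/andP => [h|[/vunitP[]// x0 xV /vunitP[]// y0 yV]].
  by split; apply: contra h => h; [apply: videalMr|apply: videalMl].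
apply/vunitP; rewrite ?rpredM // mulf_neq0 // invfM; split=> //.
exact: rpredM.
Qed.

Lemma vunitV x : x \in vring -> x \notin videal -> x^-1 \in vring.
Proof. by move=> hx /vunitP[]. Qed.

Lemma vunit_neq0 x : x \notin videal -> x != 0.
Proof. by apply: contra => /eqP ->; exact: videal0. Qed.

Lemma vunitX x n : x \in vring -> x \notin videal -> x ^+ n \notin videal.
Proof.
move=> hx ux; elim: n => [|n IHn]; first exact: videalN1.
by rewrite exprS vunitM ?rpredX // ux.
Qed.

End ValuationRing.

(** * Polynomials over a valuation ring *)

Section ValuedPolynomials.
Variables (M : fieldType) (w : valuation M).

Lemma vring_horner (p : {poly M}) x :
  p \is a polyOver (vring w) -> x \in vring w -> p.[x] \in vring w.
Proof. exact: rpred_horner. Qed.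

(** If [z] is not in the valuation ring, then [z^-1] is, and q(z) = 0 divided by a power of [z]
    expresses [z * b] as a polynomial in [z^-1] with integral coefficients. *)
Lemma vring_drop_poly (q : {poly M}) z k :
  q \is a polyOver (vring w) -> root q z ->
  (drop_poly k q).[z] \in vring w /\ z * (drop_poly k q).[z] \in vring w.
Proof.
move=> qO /rootP qz0; set b := (drop_poly k q).[z].
have [zO|zNO] := boolP (z \in vring w).
  have bO : b \in vring w.
    apply: vring_horner => //; apply/polyOverP=> l; rewrite coef_drop_poly.
    exact: (polyOverP qO).
  by split=> //; apply: rpredM.
have z0 : z != 0 by apply: contra zNO => /eqP ->; exact: rpred0.
have sO : z^-1 \in vring w by have [h|//] := vring_total w z0; rewrite h in zNO.
have bz : b * z ^+ k = - (take_poly k q).[z].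
  apply/eqP; rewrite -addr_eq0 addrC -qz0.
  by rewrite -{2}[q](poly_take_drop k) !hornerE.
suff zbO : z * b \in vring w.
  by split=> //; rewrite -[b](mulKf z0); apply: rpredM.
case: k => [|k] in b bz *; first by rewrite /b drop_poly0l qz0 mulr0 rpred0.
have -> : z * b = - \sum_(l < k.+1) q`_l * z^-1 ^+ (k - l).
  apply: (mulIf (expf_neq0 k z0)); rewrite -mulrA mulrCA -exprS bz mulNr.
  rewrite (horner_coef_wide _ (size_take_poly _ _)) mulr_suml.
  congr (- _); apply: eq_bigr => l _; rewrite coef_take_poly ltn_ord -mulrA.
  congr (_ * _).
  have -> : z ^+ k = z ^+ (k - l) * z ^+ l by rewrite -exprD subnK // leq_ord.
  rewrite exprVn mulrA.
  by rewrite mulVf ?mul1r // expf_neq0.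
rewrite rpredN; apply: rpred_sum => l _; apply: rpredM; last exact: rpredX.
exact: (polyOverP qO).
Qed.

(** Case of [vring_drop_poly] in which only the leading coefficient 1 survives, so that [z * b] is
    [z] itself. *)
Lemma vring_integral (q : {poly M}) z :
  q \is monic -> q \is a polyOver (vring w) -> root q z -> z \in vring w.
Proof.
move=> q1 qO qz; have [_] := vring_drop_poly (size q).-1 qO qz.
suff -> : drop_poly (size q).-1 q = 1 by rewrite hornerC mulr1.
apply/polyP=> l; rewrite coef_drop_poly coef1; case: l => [|l].
  exact: (monicP q1).
by rewrite nth_default // addSn -addnS prednK ?leq_addl // size_poly_gt0 monic_neq0.
Qed.

Lemma vring_prod (I : eqType) (s : seq I) (P : pred I) (f : I -> M) :
  (forall x, x \in s -> P x -> f x \in vring w) ->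
  \prod_(x <- s | P x) f x \in vring w.
Proof. by move=> fO; rewrite big_seq_cond; apply: rpred_prod => x /andP [/fO]. Qed.

Lemma vunit_prod (I : eqType) (s : seq I) (P : pred I) (f : I -> M) :
  (forall x, x \in s -> P x -> f x \in vring w) ->
  reflect (forall x, x \in s -> P x -> f x \notin videal w)
          (\prod_(x <- s | P x) f x \notin videal w).
Proof.
move=> fO; apply/(iffP idP); last first.
  move=> fu; rewrite big_seq_cond.
  (* Membership in the ring is carried along, since [vunitM] asks for it on both factors. *)
  suff /andP[] : (\prod_(x <- s | (x \in s) && P x) f x \in vring w) &&
    (\prod_(x <- s | (x \in s) && P x) f x \notin videal w) by [].
  elim/big_ind: _ => [|x y /andP[xO xu] /andP[yO yu]|x /andP[xs Px]].
  - by rewrite rpred1 videalN1.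
  - by rewrite rpredM // vunitM // xu yu.
  - by rewrite fO // fu.
elim: s fO => [//|y s IHs] fO; rewrite big_cons => hs x.
have fO' z : z \in s -> P z -> f z \in vring w.
  by move=> zs; apply: fO; rewrite inE zs orbT.
have {}IHs := IHs fO'.
case: ifP hs => Py h.
  move: h; rewrite vunitM ?vring_prod ?fO ?mem_head // => /andP[yu h].
  by rewrite inE => /predU1P[->//|]; apply: IHs.
by rewrite inE => /predU1P[->|]; [rewrite Py|apply: IHs].
Qed.

(** The element [y] is one of smallest value. Dividing a family of coefficients by it makes them
    integral, one of them being 1. *)
Lemma vring_scale (s : seq M) x : x \in s -> x != 0 ->
  exists y, [/\ y \in s, y != 0 & forall z, z \in s -> z / y \in vring w].
Proof.
elim: s x => [//|y s IHs] x xs x0.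
have [/hasP[z zs z0]|/hasPn s0] := boolP (has (fun z => z != 0) s).
  have [m [ms m0 hm]] := IHs z zs z0.
  have [ym|ym] : y / m \in vring w \/ y != 0 /\ m / y \in vring w.
    have [->|y0] := eqVneq y 0; first by left; rewrite mul0r rpred0.
    have [|h|] := @vring_total _ w (y / m); first by rewrite mulf_neq0 ?invr_eq0.
      by left.
    by rewrite invfM invrK mulrC => h; right.
    exists m; split=> //; first by rewrite inE ms orbT.
    by move=> t; rewrite inE => /predU1P[->|/hm].
  case: ym => y0 my; exists y; split=> //; first exact: mem_head.
  move=> t; rewrite inE => /predU1P[->|/hm tm]; first by rewrite divff ?rpred1.
  have -> : t / y = (t / m) * (m / y) by rewrite mulrA divfK.
  exact: rpredM.
have y0 : y != 0.
  by move: xs; rewrite inE => /predU1P[<-//|/s0]; rewrite x0.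
exists y; split=> // [|t]; first exact: mem_head.
rewrite inE => /predU1P[->|/s0]; first by rewrite divff ?rpred1.
by rewrite negbK => /eqP->; rewrite mul0r rpred0.
Qed.

End ValuedPolynomials.

Lemma deriv_prod_XsubC (R : comNzRingType) (I : eqType) (s : seq I) (f : I -> R) x :
  x \in s -> uniq s ->
  (\prod_(y <- s) ('X - (f y)%:P))^`().[f x] = \prod_(y <- s | y != x) (f x - f y).
Proof.
move=> xs us; rewrite (bigD1_seq x) //= derivM derivXsubC mul1r.
rewrite hornerD hornerM hornerXsubC subrr mul0r addr0.
by rewrite horner_prod; apply: eq_bigr => y _; rewrite hornerXsubC.
Qed.

(** * Conjugates of an algebraic element *)

Section Conjugates.
Variables (L M : fieldType) (i : {rmorphism L -> M}).
Local Notation "p ^i" := (map_poly i p) (at level 2, format "p ^i").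

(* The characteristic polynomial of multiplication by [P] modulo [h], which the
   Vandermonde matrix of the roots diagonalizes. *)
Lemma conjugates_poly (h P : {poly L}) (rs : seq M) :
  h^i = \prod_(r <- rs) ('X - r%:P) -> uniq rs ->
  exists2 chi : {poly L}, chi \is monic &
    chi^i = \prod_(r <- rs) ('X - (P^i.[r])%:P).
Proof.
move=> h_fact rs_uniq; set n := size rs.
pose W := \matrix_(s < n, t < n) ((('X^s * P) %% h)`_t).
exists (char_poly W); first exact: char_poly_monic.
have h0 : h != 0.
  by rewrite -(map_poly_eq0 i) h_fact monic_neq0 // monic_prod_XsubC.
have sz_h : size h = n.+1 by rewrite -(size_map_poly i) h_fact size_prod_XsubC.
pose a := \row_(k < n) rs`_k.
pose d := \row_(k < n) P^i.[rs`_k].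
(* Row [s] of [W] holds the coefficients of X^s P mod h, whose value at the root r_k is r_k^s P(r_k)
   because h vanishes there. *)
have WV : map_mx i W *m Vandermonde n a = Vandermonde n a *m diag_mx d.
  apply/matrixP=> s k; rewrite mul_mx_diag !mxE.
  have sz : (size (('X^s * P %% h)^i) <= n)%N.
    by rewrite size_map_poly -ltnS -sz_h ltn_modp.
  transitivity ((('X^s * P) %% h)^i.[rs`_k]).
    rewrite (horner_coef_wide _ sz); apply: eq_bigr => t _.
    by rewrite !mxE coef_map.
  have hk : h^i.[rs`_k] = 0.
    by apply/eqP; rewrite -[_ == 0]/(root _ _) h_fact root_prod_XsubC mem_nth.
  have /(congr1 (fun q => q^i.[rs`_k])) := divp_eq ('X^s * P) h.
  rewrite !(rmorphD, rmorphM) /= !hornerE hk mulr0 add0r => <-.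
  by rewrite map_polyXn hornerXn.
have V0 : \det (Vandermonde n a) != 0.
  rewrite det_Vandermonde; apply/prodf_neq0 => s _; apply/prodf_neq0 => t st.
  by rewrite !mxE subr_eq0 nth_uniq // -?(inj_eq val_inj) //= gtn_eqF.
rewrite map_char_poly (big_nth 0) big_mkord -/n.
have -> : \prod_(k < n) ('X - (P^i.[rs`_k])%:P) = char_poly (diag_mx d).
  rewrite char_poly_trig ?diag_mx_is_trig //.
  by apply: eq_bigr => k _; rewrite !mxE eqxx mulr1n.
(* The Vandermonde matrix intertwines the two characteristic matrices, and its nonzero determinant
   can be cancelled. *)
have V0' : \det (map_mx polyC (Vandermonde n a)) != 0.
  by rewrite det_map_mx polyC_eq0.
apply: (mulIf V0'); rewrite [RHS]mulrC /char_poly -!det_mulmx /char_poly_mx.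
rewrite mulmxBr mulmxBl -!map_mxM WV.
by rewrite scalar_mxC.
Qed.


Variables (w : valuation M) (h : {poly L}) (rs : seq M) (r0 : M).
Hypotheses (h_fact : h^i = \prod_(r <- rs) ('X - r%:P)) (rs_uniq : uniq rs).
Hypotheses (r0_rs : r0 \in rs) (rsO : {in rs, forall r, r \in vring w}).
Hypothesis h'r0 : h^i^`().[r0] \notin videal w.

Let h_neq0 : h != 0.
Proof. by rewrite -(map_poly_eq0 i) h_fact monic_neq0 // monic_prod_XsubC. Qed.

Let size_h : size h = (size rs).+1.
Proof. by rewrite -(size_map_poly i) h_fact size_prod_XsubC. Qed.

Let h_root r : r \in rs -> h^i.[r] = 0.
Proof. by move=> rrs; apply/rootP; rewrite h_fact root_prod_XsubC. Qed.

Lemma horner_modp_conjugate p r : r \in rs -> (p %% h)^i.[r] = p^i.[r].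
Proof.
move=> rrs; rewrite {2}(divp_eq p h) rmorphD rmorphM /= hornerD hornerM.
by rewrite h_root // mulr0 add0r.
Qed.

(* [Q * h' mod h] is the Lagrange interpolant of the values [Q(r) h'(r)], that
   is, [\sum_r Q(r) h(X) / (X - r)]. *)
Lemma vring_modp_deriv (Q : {poly L}) :
  {in rs, forall r, Q^i.[r] \in vring w} ->
  (Q * h^`() %% h)^i \is a polyOver (vring w).
Proof.
move=> QO; set G := _ %% _.
pose K := \sum_(r <- rs) Q^i.[r] *: \prod_(s <- rs | s != r) ('X - s%:P).
suff -> : G^i = K.
  rewrite /K big_seq; apply: rpred_sum => r rrs.
  apply: polyOverZ; first exact: QO.
  rewrite big_seq_cond; apply: rpred_prod => s /andP[srs _].
  by rewrite polyOverXsubC rsO.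
(* Both sides have degree less than the number of roots, so agreement at each root suffices. *)
apply/eqP; rewrite -subr_eq0; apply/eqP.
apply: (@roots_geq_poly_eq0 _ _ rs) => //.
  apply/allP=> r rrs; rewrite /root hornerD hornerN subr_eq0; apply/eqP.
  rewrite horner_modp_conjugate // rmorphM hornerM /= -deriv_map.
  rewrite h_fact (deriv_prod_XsubC id) //= horner_sum (bigD1_seq r) //=.
  rewrite [X in _ = _ + X]big1_seq ?addr0; last first.
    move=> s /andP[sr srs] /=; rewrite hornerZ.
    suff /rootP -> : root (\prod_(t <- rs | t != s) ('X - t%:P)) r.
      by rewrite mulr0.
    by rewrite -big_filter root_prod_XsubC mem_filter eq_sym sr.
  by rewrite hornerZ horner_prod; congr (_ * _); apply: eq_bigr => s _;
    rewrite hornerXsubC.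
have szG : (size (G^i) <= size rs)%N.
  by rewrite size_map_poly -ltnS -size_h ltn_modp.
rewrite (leq_trans (size_polyD _ _)) // geq_max szG size_polyN /=.
apply: (leq_trans (size_sum _ _ _)); apply/bigmax_leqP_seq => r rrs _.
apply: (leq_trans (size_scale_leq _ _)).
rewrite -big_filter size_prod_XsubC size_filter -(count_predC (pred1 r) rs).
by rewrite count_uniq_mem // rrs add1n ltnS leqnn.
Qed.

(* The argument behind "the valuation ring is a localization of the integral
   closure": if [a_n z^n + ... + a_0 = 0] with [a_k] the last unit coefficient,
   then [b := a_n z^(n-k) + ... + a_k] is a unit, while [b] and [b z] have
   integral conjugates. *)
Lemma vring_quotient (Q : {poly L}) : Q^i.[r0] \in vring w ->
  exists B C : {poly L}, [/\ B^i \is a polyOver (vring w),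
    C^i \is a polyOver (vring w), B^i.[r0] \notin videal w &
    Q^i.[r0] * B^i.[r0] = C^i.[r0]].
Proof.
move=> zO; have [chi chi1 chi_fact] := conjugates_poly Q h_fact rs_uniq.
(* Dividing the characteristic polynomial by a coefficient of smallest value makes it integral with
   a unit coefficient, at the price of monicity. *)
have [y [ys y0 hy]] : exists y, [/\ y \in (chi : seq L), y != 0 &
    forall a, a \in (chi : seq L) -> i (a / y) \in vring w].
  have c1 : i 1 \in [seq i a | a <- (chi : seq L)].
    by rewrite map_f // -(monicP chi1) mem_nth // prednK // size_poly_gt0 monic_neq0.
  have := @vring_scale _ w _ _ c1; rewrite fmorph_eq0 oner_neq0 => /(_ isT).
  case=> y' [/mapP[y ys ->] y0 hy]; exists y; split=> //.
    by rewrite -(fmorph_eq0 i).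
  by move=> a achi; rewrite fmorph_div; apply/hy/map_f.
pose q := y^-1 *: chi.
have qO : q^i \is a polyOver (vring w).
  apply/polyOverP=> k; rewrite coef_map /= coefZ mulrC.
  have [kchi|kchi] := ltnP k (size chi); first exact/hy/mem_nth.
  by rewrite nth_default // mul0r rmorph0 rpred0.
have qr r : r \in rs -> root q^i Q^i.[r].
  move=> rrs; rewrite map_polyZ rootZ ?fmorph_eq0 ?invr_eq0 // chi_fact.
  by rewrite -(big_map (fun r => Q^i.[r]) xpredT (fun x => 'X - x%:P))
    root_prod_XsubC map_f.
have ex_k : exists k, i q`_k \notin videal w.
  exists (index y chi); rewrite coefZ nth_index // mulVf // rmorph1.
  exact: videalN1.
have ub_k k : i q`_k \notin videal w -> (k <= size q)%N.
  apply: contraR; rewrite -ltnNge => /ltnW ?.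
  by rewrite nth_default // rmorph0 rpred0.
case: (ex_maxnP ex_k ub_k) => k qk k_max {ex_k ub_k}.
pose B0 := drop_poly k q \Po Q.
have map_drop : (drop_poly k q)^i = drop_poly k q^i.
  by apply/polyP=> l; rewrite !(coef_map, coef_drop_poly).
have B0r r : B0^i.[r] = (drop_poly k q^i).[Q^i.[r]].
  by rewrite map_comp_poly horner_comp map_drop.
have B0O r : r \in rs -> B0^i.[r] \in vring w /\ (B0 * Q)^i.[r] \in vring w.
  move=> rrs; rewrite rmorphM hornerM B0r mulrC.
  exact: vring_drop_poly qO (qr r rrs).
(* The constant term is the k-th coefficient of [q], a unit; by maximality of [k] all higher
   coefficients lie in the maximal ideal. *)
have B0u : B0^i.[r0] \notin videal w.
  rewrite B0r -[drop_poly k q^i](poly_take_drop 1) hornerD hornerM.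
  rewrite hornerXn expr1; set t := (take_poly _ _).[_].
  have -> : t = i q`_k.
    rewrite /t (horner_coef_wide _ (size_take_poly _ _)) big_ord1.
    by rewrite coef_take_poly coef_drop_poly coef_map expr0 mulr1.
  apply: contra qk => /rpredB h1.
  suff /h1 : (drop_poly 1 (drop_poly k q^i)).[Q^i.[r0]] * Q^i.[r0] \in videal w.
    by rewrite addrK.
  apply: videalMr => //; rewrite horner_coef; apply: rpred_sum => l _.
  apply: videalMr; last exact: rpredX.
  rewrite !coef_drop_poly coef_map; apply/negPn/negP => /k_max.
  by rewrite addn1 leqNgt ltnS leq_addl.
(* The factor h' turns integral values at the roots into integral coefficients; as h'(r0) is a unit,
   the value of [B0] at [r0] stays a unit. *)
exists (B0 * h^`() %% h), (B0 * Q * h^`() %% h); split.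
- by apply: vring_modp_deriv => r /B0O[].
- by apply: vring_modp_deriv => r /B0O[].
- rewrite horner_modp_conjugate // rmorphM hornerM /= -deriv_map vunitM ?B0u //.
    by have [] := B0O _ r0_rs.
  rewrite h_fact (deriv_prod_XsubC id) //; apply: vring_prod => s srs _.
  by rewrite rpredB // rsO.
- rewrite !horner_modp_conjugate // !rmorphM !hornerM /=.
  by rewrite mulrCA mulrA.
Qed.

(* Fitting's lemma modulo the maximal ideal: some multiple [x] of [U] is
   idempotent up to nilpotents, hence [E := x^(N+1)] is congruent to 0 or 1 at
   every conjugate. *)
Lemma conjugate_idempotent (U : {poly L}) :
  U^i \is a polyOver (vring w) -> U^i.[r0] \notin videal w ->
  exists V : {poly L}, [/\ V^i \is a polyOver (vring w),
    1 - (V * U)^i.[r0] \in videal w &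
    {in rs, forall r, (V * U)^i.[r] \in videal w \/ 1 - (V * U)^i.[r] \in videal w}].
Proof.
move=> UO Uu; have [f f1 f_fact] := conjugates_poly U h_fact rs_uniq.
have UrO r : r \in rs -> U^i.[r] \in vring w by move=> /rsO; apply: vring_horner.
have fO : f^i \is a polyOver (vring w).
  rewrite f_fact big_seq; apply: rpred_prod => r /UrO rO.
  by rewrite polyOverXsubC.
have fr r : r \in rs -> f^i.[U^i.[r]] = 0.
  move=> rrs; apply/rootP; rewrite f_fact.
  by rewrite -(big_map (fun r => U^i.[r]) xpredT (fun x => 'X - x%:P))
    root_prod_XsubC map_f.
have fkO k : i f`_k \in vring w by have := polyOverP fO k; rewrite coef_map.
(* [N] is the lowest index of a unit coefficient c. Write f = t + X^N (c + X g) with t having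
   coefficients in the maximal ideal: as f vanishes at each U(r), the value of U^N (1 - x) lies in
   the maximal ideal for x = - U g(U) / c. *)
have ex_N : exists k, i f`_k \notin videal w.
  exists (size f).-1; rewrite -[_`_ _]/(lead_coef f) (monicP f1) rmorph1.
  exact: videalN1.
case: (ex_minnP ex_N) => N fN N_min.
have fN0 : i f`_N != 0 := vunit_neq0 fN.
pose g := drop_poly N.+1 f.
pose b : {poly L} := - (f`_N)^-1 *: (g \Po U).
have bO : b^i \is a polyOver (vring w).
  rewrite map_polyZ; apply: polyOverZ.
    by rewrite rmorphN rpredN fmorphV; apply: vunitV.
  rewrite map_comp_poly; apply: polyOver_comp => //.
  by apply/polyOverP=> k; rewrite coef_map coef_drop_poly; apply: fkO.
pose x := b * U.
have xO r : r \in rs -> x^i.[r] \in vring w.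
  move=> rrs; rewrite rmorphM hornerM rpredM ?UrO //.
  exact: vring_horner bO (rsO rrs).
have x_idem r : r \in rs -> U^i.[r] ^+ N * (1 - x^i.[r]) \in videal w.
  move=> rrs; set u := U^i.[r].
  suff [t tm ht] : exists2 t, t \in videal w & t + u ^+ N * (i f`_N * (1 - x^i.[r])) = 0.
    have -> : u ^+ N * (1 - x^i.[r]) = - (i f`_N)^-1 * t.
      move/eqP: ht; rewrite addr_eq0 => /eqP ->.
      by rewrite mulrNN [in RHS]mulrCA mulKf.
    by rewrite videalMl // rpredN; apply: vunitV.
  exists (take_poly N f^i).[u].
    rewrite (horner_coef_wide _ (size_take_poly _ _)); apply: rpred_sum => l _.
    rewrite coef_take_poly ltn_ord coef_map; apply: videalMr.
      by apply/negPn/negP => /N_min; rewrite leqNgt ltn_ord.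
    by rewrite rpredX // UrO.
  rewrite -(fr r rrs) -/u -[in RHS](poly_take_drop N f^i) hornerD hornerM hornerXn.
  congr (_ + _).
  rewrite mulrC; congr (_ * _).
  have -> : drop_poly N f^i = (i f`_N)%:P + g^i * 'X.
    apply/polyP=> k; rewrite coefD coefMX coefC coef_drop_poly coef_map.
    by case: k => [|k] /=; rewrite ?addr0 // add0r coef_map coef_drop_poly addnS.
  rewrite !hornerE /x rmorphM hornerM /= map_polyZ hornerZ map_comp_poly horner_comp.
  rewrite -/u mulrBr mulr1 rmorphN fmorphV !mulNr mulrN opprK !mulrA divff //.
  by rewrite mul1r.
(* At each conjugate, either U lies in the maximal ideal and so does its multiple x, or U is a unit
   and can be cancelled from U^N (1 - x). *)
have x01 r : r \in rs -> x^i.[r] \in videal w \/ 1 - x^i.[r] \in videal w.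
  move=> rrs; have xrO := xO r rrs; have cO : 1 - x^i.[r] \in vring w.
    by rewrite rpredB // rpred1.
  have [|Ur] := boolP (U^i.[r] \in videal w).
    move=> Ur; left; rewrite rmorphM hornerM videalMl //.
    exact: vring_horner bO (rsO rrs).
  right; apply/negPn/negP => cr; have := x_idem r rrs.
  apply/negP; rewrite vunitM ?rpredX ?UrO // cr andbT.
  by rewrite vunitX ?UrO.
have xr0 : 1 - x^i.[r0] \in videal w.
  apply/negPn/negP => cr; have := x_idem r0 r0_rs; apply/negP.
  have cO : 1 - x^i.[r0] \in vring w by rewrite rpredB ?rpred1 ?xO.
  by rewrite vunitM ?cr ?vunitX ?UrO //; apply/rpredX/UrO.
have sub1X r : r \in rs -> 1 - x^i.[r] \in videal w ->
    1 - (x ^+ N.+1)^i.[r] \in videal w.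
  move=> rrs cm; rewrite rmorphXn horner_exp -[in X in X - _](expr1n _ N.+1).
  rewrite subrXX videalMr //; apply: rpred_sum => l _.
  by rewrite expr1n mul1r rpredX // xO.
have VU : b * x ^+ N * U = x ^+ N.+1 by rewrite exprSr mulrAC [RHS]mulrC.
exists (b * x ^+ N); rewrite VU; split.
- by rewrite rmorphM rmorphXn rmorphM /= !rpredM // rpredX // rpredM.
- exact: sub1X.
- move=> r rrs; case: (x01 r rrs) => [xm|cm]; [left|right; exact: sub1X].
  by rewrite exprS rmorphM hornerM videalMr // rmorphXn horner_exp rpredX ?xO.
Qed.

(** For r other than [r0], the multiple W below is congruent to 0 or r at r, and to [r0] at [r0].
    The differences are then congruent to [r0] or r0 - r, both units, so the derivative of the
    characteristic polynomial is a unit. *)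
Lemma henselian_multiple (U : {poly L}) :
  r0 \notin videal w ->
  U^i \is a polyOver (vring w) -> U^i.[r0] \notin videal w ->
  exists V chi : {poly L}, [/\ V^i \is a polyOver (vring w),
    chi^i \is a polyOver (vring w), (V * U)^i.[r0] \notin videal w,
    chi^i.[(V * U)^i.[r0]] = 0 & chi^i^`().[(V * U)^i.[r0]] \notin videal w].
Proof.
move=> r0u UO Uu; have [V [VO E1 E01]] := conjugate_idempotent UO Uu.
have EO r : r \in rs -> (V * U)^i.[r] \in vring w.
  move=> rrs; apply: vring_horner (rsO rrs); rewrite rmorphM; exact: rpredM.
(* The idempotent [V * U] may have residue 1 at several conjugates; the factor X tells the others
   apart from [r0]. *)
pose W := V * 'X * U; have WE r : W^i.[r] = r * (V * U)^i.[r].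
  by rewrite !rmorphM /= map_polyX !hornerM hornerX mulrAC mulrC.
have WO r : r \in rs -> W^i.[r] \in vring w.
  by move=> rrs; rewrite WE rpredM ?EO ?rsO.
have r0O := rsO r0_rs.
have Eu : (V * U)^i.[r0] \notin videal w.
  by apply: contra (videalN1 w) => Em; have := rpredD E1 Em; rewrite subrK.
have [chi chi1 chi_fact] := conjugates_poly W h_fact rs_uniq.
exists (V * 'X), chi; rewrite -/W; split.
- by rewrite rmorphM /= map_polyX rpredM ?polyOverX.
- by rewrite chi_fact big_seq; apply: rpred_prod => r /WO rO; rewrite polyOverXsubC.
- by rewrite WE vunitM ?EO // r0u.
- apply/rootP; rewrite chi_fact.
  by rewrite -(big_map (fun r => W^i.[r]) xpredT (fun x => 'X - x%:P))
    root_prod_XsubC (map_f (fun r => W^i.[r])).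
rewrite chi_fact (deriv_prod_XsubC (fun r => W^i.[r])) //.
apply/vunit_prod => [r rrs _|r rrs r_r0]; first by rewrite rpredB ?WO.
have r0r : r0 - r \notin videal w.
  move: h'r0; rewrite h_fact (deriv_prod_XsubC id) // => /vunit_prod; apply=> //.
  by move=> s srs _; rewrite rpredB ?rsO.
have W0 : r0 - W^i.[r0] \in videal w.
  by rewrite WE -{1}[r0]mulr1 -mulrBr videalMl.
case: (E01 r rrs) => Er.
  apply: contra r0u => Wm.
  have -> : r0 = (r0 - W^i.[r0]) + ((W^i.[r0] - W^i.[r]) + W^i.[r]).
    by rewrite !subrK.
  apply: rpredD => //; apply: rpredD => //.
  by rewrite WE videalMl // rsO.
apply: contra r0r => Wm.
have Wr : r - W^i.[r] \in videal w by rewrite WE -{1}[r]mulr1 -mulrBr videalMl // rsO.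
have -> : r0 - r = (r0 - W^i.[r0]) + ((W^i.[r0] - W^i.[r]) - (r - W^i.[r])).
  by rewrite opprB !addrA !subrK.
by apply: rpredD => //; apply: rpredB.
Qed.

End Conjugates.

(** * Prime ideals *)

Section PrimeIdeals.
Variables (K : fieldType) (R : set K).
Hypothesis R_subring : subring_closed (mem R).

Lemma set_ring1 : R 1.
Proof. by case: R_subring => + _ _; rewrite inE. Qed.

Lemma set_ringB x y : R x -> R y -> R (x - y).
Proof.
case: R_subring => _ RB _ Rx Ry.
by have := RB x y; rewrite !inE; apply.
Qed.

Lemma set_ringM x y : R x -> R y -> R (x * y).
Proof.
case: R_subring => _ _ RM Rx Ry.
by have := RM x y; rewrite !inE; apply.
Qed.

Lemma set_ring0 : R 0.
Proof. by rewrite -(subrr 1); apply: set_ringB; exact: set_ring1. Qed.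

Lemma set_ringN x : R x -> R (- x).
Proof. by rewrite -sub0r; apply: set_ringB; exact: set_ring0. Qed.

Lemma set_ringD x y : R x -> R y -> R (x + y).
Proof. by move=> Rx Ry; rewrite -[y]opprK; apply/set_ringB/set_ringN. Qed.

Lemma set_ringX x n : R x -> R (x ^+ n).
Proof.
move=> Rx; elim: n => [|n IHn]; first exact: set_ring1.
by rewrite exprS; apply: set_ringM.
Qed.

Lemma set_ring_prod (I : Type) (s : seq I) (P : pred I) (f : I -> K) :
  (forall l, P l -> R (f l)) -> R (\prod_(l <- s | P l) f l).
Proof.
by move=> Rf; apply: (big_ind R) => //; [exact: set_ring1|exact: set_ringM].
Qed.

Section PrimeIdealTheory.
Variable P : set K.
Hypothesis P_prime : prime_ideal R P.

Lemma prime_sub x : P x -> R x. Proof. by case: P_prime => + _ _ _; apply. Qed.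

Lemma prime0 : P 0. Proof. by case: P_prime => _ []. Qed.

Lemma primeN1 : ~ P 1. Proof. by case: P_prime. Qed.

Lemma primeMl a x : R a -> P x -> P (a * x).
Proof.
move=> Ra Px; case: P_prime => _ [P0 PD] _ _.
by rewrite -[a * x]addr0; apply: PD.
Qed.

Lemma primeMr a x : P x -> R a -> P (x * a).
Proof. by move=> Px Ra; rewrite mulrC; apply: primeMl. Qed.

Lemma primeD x y : P x -> P y -> P (x + y).
Proof.
move=> Px Py; case: P_prime => _ [_ PD] _ _.
by rewrite -[x]mul1r; apply: PD => //; exact: set_ring1.
Qed.

Lemma primeN x : P x -> P (- x).
Proof. by rewrite -mulN1r; apply: primeMl; apply/set_ringN/set_ring1. Qed.

Lemma prime_mul x y : R x -> R y -> P (x * y) -> P x \/ P y.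
Proof. by case: P_prime => _ _ _; apply. Qed.

Lemma prime_prod (I : eqType) (s : seq I) (f : I -> K) :
  (forall l, l \in s -> R (f l)) -> P (\prod_(l <- s) f l) ->
  exists2 l, l \in s & P (f l).
Proof.
elim: s => [|l s IHs] Rf; first by rewrite big_nil => /primeN1.
have Rf' k : k \in s -> R (f k) by move=> ks; apply: Rf; rewrite inE ks orbT.
rewrite big_cons => /prime_mul[].
- by apply: Rf; exact: mem_head.
- by rewrite big_seq; apply: set_ring_prod.
- by exists l => //; exact: mem_head.
- by move=> /(IHs Rf')[k ks Pk]; exists k; rewrite // inE ks orbT.
Qed.

Lemma prime_prod_mem (I : eqType) (s : seq I) (f : I -> K) l :
  (forall k, k \in s -> R (f k)) -> l \in s -> P (f l) -> P (\prod_(k <- s) f k).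
Proof.
elim: s => [//|k s IHs] Rf; have Rf' m : m \in s -> R (f m).
  by move=> ms; apply: Rf; rewrite inE ms orbT.
rewrite big_cons inE => /predU1P[-> Pk|ls Pl].
  by apply: primeMr => //; rewrite big_seq; apply: set_ring_prod.
by apply: primeMl; [apply: Rf; exact: mem_head|apply: IHs].
Qed.

Lemma prime_sum (I : Type) (s : seq I) (Q : pred I) (f : I -> K) :
  (forall l, Q l -> P (f l)) -> P (\sum_(l <- s | Q l) f l).
Proof. by move=> Pf; apply: (big_ind P) => //; [exact: prime0|exact: primeD]. Qed.

End PrimeIdealTheory.

(** By Zorn's lemma, if no power of [u] is a multiple of [x], some ideal is maximal among those
    containing [x] and no power of [u]; it is prime, contradicting the hypothesis. *)
Lemma prime_radical x u : R x -> R u ->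
  (forall P, prime_ideal R P -> P x -> P u) ->
  exists k y, R y /\ u ^+ k = x * y.
Proof.
move=> Rx Ru xu; apply: contrapT => nxu.
(* The union of the empty chain must qualify, so [x] is demanded only of nonempty sets; maximality
   later forces [x] in. *)
pose ok (A : set K) := [/\ A `<=` R, forall a y z, R a -> A y -> A z -> A (a * y + z),
  forall k, ~ A (u ^+ k) & forall z, A z -> A x].
(* Adding [b] to a maximal ideal gives a strictly larger one, which can fail [ok] only by containing
   a power of [u]. *)
have ok_sum A b : ok A -> A x -> R b -> ~ A b ->
    (forall B, A `<` B -> ~ ok B) -> exists k a c, [/\ A a, R c & u ^+ k = a + c * b].
  move=> [AR AD Au _] Ax Rb nAb maxA.
  pose B := [set z | exists a c, [/\ A a, R c & z = a + c * b]].
  have A0 : A 0.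
    have := AD (- 1) x x (set_ringN set_ring1) Ax Ax.
    by rewrite mulN1r addNr.
  have AB : A `<=` B.
    by move=> z Az; exists z, 0; split=> //; [exact: set_ring0|rewrite mul0r addr0].
  apply: contrapT => nB; apply: (maxA B).
    split=> // BA; apply/nAb/BA; exists 0, 1; split=> //; first exact: set_ring1.
    by rewrite mul1r add0r.
  split.
  - by move=> _ [a [c [/AR Ra Rc ->]]]; apply/set_ringD/set_ringM.
  - move=> d _ _ Rd [a [c [Aa Rc ->]]] [a' [c' [Aa' Rc' ->]]].
    exists (d * a + a'), (d * c + c'); split; first exact: AD.
      by apply: set_ringD => //; apply: set_ringM.
    by rewrite mulrDr mulrDl mulrA addrACA.
  - by move=> k [a [c [Aa Rc uk]]]; apply: nB; exists k, a, c.
  - by move=> _ _; exact: AB.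
have [|A [okA maxA]] := @Zorn_bigcup K ok.
  move=> C Cok Ctot; split.
  - by move=> z [A CA Az]; have [+ _ _ _] := Cok A CA; apply.
  - move=> a y z Ra [A CA Ay] [B CB Bz].
    have [AB|BA] := Ctot A B CA CB.
      by exists B => //; have [_ + _ _] := Cok B CB; apply=> //; apply: AB.
    by exists A => //; have [_ + _ _] := Cok A CA; apply=> //; apply: BA.
  - by move=> k [A CA Ak]; have [_ _ + _] := Cok A CA; apply; exact: Ak.
  - by move=> z [A CA Az]; exists A => //; have [_ _ _] := Cok A CA; apply; exact: Az.
have Ax : A x.
  apply: contrapT => nAx; apply: (maxA [set z | exists y, R y /\ z = x * y]).
    have [_ _ _ A_x] := okA; split; first by move=> z /A_x.
    by move=> sub; apply/nAx/sub; exists 1; rewrite mulr1; split=> //; exact: set_ring1.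
  split.
  - by move=> _ [y [Ry ->]]; apply: set_ringM.
  - move=> a _ _ Ra [y [Ry ->]] [z [Rz ->]]; exists (a * y + z).
    by rewrite mulrDr mulrCA; split=> //; apply/set_ringD => //; apply: set_ringM.
  - by move=> k [y [Ry uk]]; apply: nxu; exists k, y.
  - by move=> _ _; exists 1; rewrite mulr1; split=> //; exact: set_ring1.
have [AR AD Au _] := okA.
have A0 : A 0.
  have := AD (- 1) x x (set_ringN set_ring1) Ax Ax.
  by rewrite mulN1r addNr.
have AM a z : R a -> A z -> A (a * z) by move=> Ra Az; rewrite -[_ * _]addr0; apply: AD.
apply: (Au 1); apply: xu => //; split=> //.
  by have := Au 0.
move=> a b Ra Rb Aab; apply: contrapT => /not_orP[nAa nAb].
have [k [c [d [Ac Rd uk]]]] := ok_sum A a okA Ax Ra nAa maxA.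
have [l [e [g [Ae Rg ul]]]] := ok_sum A b okA Ax Rb nAb maxA.
(* Every term of the expanded product has a factor in the ideal: [c], [e] or [a * b]. *)
apply: (Au (k + l)); rewrite exprD uk ul mulrDl.
have -> : c * (e + g * b) + d * a * (e + g * b) =
    (e + g * b) * c + ((d * a) * e + (d * g) * (a * b)) by ring.
apply: (AD) => //; first by apply: set_ringD; [exact: AR|exact: set_ringM].
by apply: AD => //; [exact: set_ringM|apply: AM => //; exact: set_ringM].
Qed.

End PrimeIdeals.

(** * Primes of integral extensions of a valuation ring *)

Section PrimesOverValuationRing.
Variables (L : fieldType) (F : fieldExtType L) (v : valuation F) (R : set F).
Local Notation OL := (base_valuation_ring v).
Hypotheses (R_subring : subring_closed (mem R)) (OL_R : OL `<=` R).

Lemma base_vring (a : L) : a%:A \in vring v -> OL a%:A.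
Proof. by move=> /asboolP ?; split=> //=; rewrite rpredZ ?rpred1. Qed.

(* Pick [x_i] in all the primes but the i-th: scaling a linear relation between
   them by its coefficient of smallest value puts some [x_j] in the j-th prime. *)
Lemma antichain_primes_size (s : seq (set F)) :
  (forall k, (k < size s)%N -> prime_ideal R (nth set0 s k)) ->
  (forall k l, (k < size s)%N -> (l < size s)%N -> k != l ->
    ~ (nth set0 s k `<=` nth set0 s l)) ->
  (size s <= \dim {:F})%N.
Proof.
move=> s_prime s_anti; rewrite leqNgt; apply/negP => dim_s.
set n := size s in s_prime s_anti dim_s; pose Q k := nth set0 s k.
(* The product of elements taken from each other prime and outside [Q k]; primality keeps the
   product outside [Q k]. *)
have x_ex (k : 'I_n) : exists x, [/\ R x, ~ Q k x & forall l : 'I_n, l != k -> Q l x].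
  have Qk := s_prime k (ltn_ord k).
  have /choice[z hz] (l : 'I_n) : exists z, [/\ R z, ~ Q k z & l != k -> Q l z].
    have [->|lk] := eqVneq l k; first by exists 1; split=> //; [exact: set_ring1|apply: primeN1 Qk].
    have /existsNP[z /not_implyP[Qz nQz]] := s_anti l k (ltn_ord l) (ltn_ord k) lk.
    by exists z; split=> //; apply: prime_sub (s_prime l (ltn_ord l)) _ Qz.
  exists (\prod_(l <- enum 'I_n) z l); split.
  - by apply: set_ring_prod => // l _; case: (hz l).
  - by move/(prime_prod R_subring Qk) => [l _|l _]; case: (hz l).
  - move=> l lk; apply: (prime_prod_mem R_subring (s_prime l (ltn_ord l)) (l := l)).
    + by move=> m _; case: (hz m).
    + by rewrite mem_enum.
    + by case: (hz l) => _ _; apply.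
have /choice[x hx] := x_ex.
have : ~~ free [tuple x k | k < n].
  apply/negP; rewrite /free size_tuple => /eqP sz.
  by move: dim_s; rewrite -sz ltnNge dimvS ?subvf.
move/freeP => /existsNP[c] /not_implyP[c_sum /existsNP[k0 /eqP ck0]].
have c_mem k : (c k)%:A \in [seq ((c k)%:A : F) | k : 'I_n].
  by apply: map_f; rewrite mem_enum.
have := vring_scale v (c_mem k0).
rewrite scaler_eq0 oner_eq0 orbF => /(_ ck0)[y [/mapP[j _ ->]]].
rewrite scaler_eq0 oner_eq0 orbF => cj hc.
have [_ nQx _] := hx j; apply: nQx.
have Qj := s_prime j (ltn_ord j).
have -> : x j = - \sum_(k | k != j) (c k / c j)%:A * x k.
  have : (c j)^-1 *: \sum_(k < n) c k *: x k = 0.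
    rewrite -[RHS](scaler0 _ (c j)^-1) -[in RHS]c_sum; congr (_ *: _).
    by apply: eq_bigr => k _; rewrite -tnth_nth tnth_mktuple.
  rewrite (bigD1 j) //= scalerDr scalerA mulVf // scale1r => /eqP.
  rewrite addr_eq0 => /eqP ->; rewrite scaler_sumr; congr (- _).
  by apply: eq_bigr => k _; rewrite scalerA mulr_algl mulrC.
apply: (primeN R_subring Qj); apply: (prime_sum R_subring Qj) => k kj.
apply: (primeMl Qj); last by case: (hx k) => _ _; apply; rewrite eq_sym.
apply/OL_R/base_vring; have := hc _ (c_mem k).
suff -> : (c k)%:A / (c j)%:A = (c k / c j)%:A :> F by [].
by rewrite -!in_algE fmorph_div.
Qed.

Lemma contraction_prime (P : set F) : prime_ideal R P -> prime_ideal OL (OL `&` P).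
Proof.
have OLD x y : OL x -> OL y -> OL (x + y).
  move=> [Ox x1] [Oy y1]; split; last exact: rpredD.
  by apply/asboolP/(@rpredD _ (vring v)); apply/asboolP.
have OLM x y : OL x -> OL y -> OL (x * y).
  move=> [Ox x1] [Oy y1]; split; last exact: rpredM.
  by apply/asboolP/(@rpredM _ (vring v)); apply/asboolP.
move=> Pp; split.
- by move=> x [].
- split.
    by split; [split; [left|exact: rpred0]|exact: prime0 Pp].
  move=> a x y Oa [Ox Px] [Oy Py]; split; first by apply/OLD => //; exact: OLM.
  by apply: (primeD R_subring Pp) => //; apply: primeMl Pp _ _ (OL_R Oa) Px.
- by move=> [_ /(primeN1 Pp)].
- move=> x y Ox Oy [_ Pxy].
  by have [] := prime_mul Pp (OL_R Ox) (OL_R Oy) Pxy; [left|right].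
Qed.

Hypothesis R_integral : forall x, R x -> exists f : {poly L},
  [/\ f \is monic, forall k, (f`_k)%:A \in vring v & (map_poly (in_alg F) f).[x] = 0].

(** If x in [Q] lay outside [P], every integral polynomial with value in [P] at x would have all
    coefficients in [P]: the constant one is in [Q], hence in [P], and then x can be cancelled. A
    monic equation for x would put 1 in [P]. *)
Lemma primes_incomparable (P Q : set F) : prime_ideal R P -> prime_ideal R Q ->
  P `<=` Q -> OL `&` Q `<=` P -> Q `<=` P.
Proof.
move=> Pp Qp PQ QP x Qx; apply: contrapT => nPx.
have Rx := prime_sub Qp Qx.
have [f [f1 fO fx]] := R_integral Rx.
(* Values in [P], rather than just the value 0, are what the induction on the polynomial
   preserves. *)
suff : forall g : {poly L}, (forall k, (g`_k)%:A \in vring v) ->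
    P (map_poly (in_alg F) g).[x] -> forall k, P (g`_k)%:A.
  move=> /(_ f fO); rewrite fx => /(_ (prime0 Pp) (size f).-1).
  rewrite -[_`_ _]/(lead_coef f) (monicP f1) scale1r; exact: primeN1 Pp.
elim/poly_ind => [|g c IHg] gO; first by move=> _ k; rewrite coef0 scale0r; exact: prime0 Pp.
have gO' k : (g`_k)%:A \in vring v.
  by have := gO k.+1; rewrite coefD coefMX coefC addr0.
have cO : OL c%:A.
  by apply: base_vring; have := gO 0; rewrite coefD coefMX coefC add0r.
have Rg : R (map_poly (in_alg F) g).[x].
  rewrite horner_coef; apply: (big_ind R) => [||k _].
  - exact: set_ring0.
  - exact: set_ringD.
  - apply: (set_ringM R_subring); last exact: set_ringX.
    by rewrite coef_map; apply/OL_R/base_vring.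
rewrite rmorphD rmorphM /= map_polyX map_polyC hornerD hornerM hornerX hornerC /= => Pgx.
have Pc : P c%:A.
  apply: QP; split=> //.
  have -> : c%:A = ((map_poly (in_alg F) g).[x] * x + c%:A) - (map_poly (in_alg F) g).[x] * x.
    by rewrite addrAC subrr add0r.
  apply: (primeD R_subring Qp); first exact: PQ.
  by apply: (primeN R_subring Qp); apply: primeMl Qp _ _ Rg Qx.
have Pg : P (map_poly (in_alg F) g).[x].
  have [|//|//] := prime_mul Pp Rg Rx.
  have -> : (map_poly (in_alg F) g).[x] * x = ((map_poly (in_alg F) g).[x] * x + c%:A) - c%:A.
    by rewrite addrK.
  by apply: (primeD R_subring Pp) => //; apply: (primeN R_subring Pp).
move=> [|k]; rewrite coefD coefMX coefC; first by rewrite add0r.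
by rewrite addr0; apply: IHg.
Qed.

Lemma element_of_primes_not_below (n : set F) :
  wo_chain (fun P Q : set F => `[< P `<=` Q >])
    (mem [set P : set F | prime_ideal OL P]) ->
  prime_ideal R n ->
  exists u, [/\ R u, ~ n u &
    forall P, prime_ideal R P -> ~ (P `<=` n) -> P u].
Proof.
move=> OL_wo n_prime.
pose S P := prime_ideal R P /\ ~ (P `<=` n).
pose minS Q := S Q /\ forall P, S P -> P `<=` Q -> Q `<=` P.
(* Among the primes of [S] below [P], one has the least contraction by well-ordering; by
   incomparability it is minimal in [S]. *)
have minS_ex P : S P -> exists2 Q, minS Q & Q `<=` P.
  move=> SP.
  pose C := [set OL `&` Q | Q in [set Q | S Q /\ Q `<=` P]].
  have C_prime : {subset mem C <= mem [set P : set F | prime_ideal OL P]}.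
    by move=> _ /set_mem[Q [[Qp _] _] <-]; apply/mem_set/contraction_prime.
  have C_ne : nonempty (mem C).
    by exists (OL `&` P); apply/mem_set; exists P => //; split.
  have [_ [[/set_mem[Q [SQ QP] <-] minQ] _]] := OL_wo (mem C) C_prime C_ne.
  exists Q => //; split=> // P' SP' P'Q.
  have /minQ/asboolP QP' : OL `&` P' \in mem C.
    by apply/mem_set; exists P' => //; split=> // z /P'Q /QP.
  apply: primes_incomparable => //; first by case: SP'.
    by case: SQ.
  by move=> z /QP'[].
(* Antichains of minimal members of [S] have length at most the dimension, so a longest one
   exists. *)
pose anti (s : seq (set F)) := forall k l, (k < size s)%N -> (l < size s)%N ->
  k != l -> ~ (nth set0 s k `<=` nth set0 s l).
pose good k := `[< exists s : seq (set F), [/\ size s = k,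
  forall l, (l < size s)%N -> minS (nth set0 s l) & anti s] >].
have ex_good : exists k, good k by exists 0; apply/asboolP; exists [::].
have ub_good k : good k -> (k <= \dim {:F})%N.
  move=> /asboolP[s [<- s_min s_anti]]; apply: antichain_primes_size => // l ls.
  by have [[]] := s_min l ls.
case: (ex_maxnP ex_good ub_good) => m /asboolP[s [s_size s_min s_anti]] m_max.
(* Otherwise [Q] could be prepended to the longest antichain. *)
have s_all Q : minS Q -> exists2 k, (k < size s)%N & nth set0 s k `<=` Q.
  move=> minQ; apply: contrapT => nQ.
  suff /m_max : good m.+1 by rewrite ltnn.
  apply/asboolP; exists (Q :: s); split; first by rewrite /= s_size.
    by case=> [|l] //=; rewrite ltnS => /s_min.
  have Q_anti l : (l < size s)%N -> ~ (nth set0 s l `<=` Q).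
    by move=> ls lQ; apply: nQ; exists l.
  case=> [|k] [|l] //=; rewrite !ltnS.
  - move=> _ ls _ Ql; apply: (Q_anti l ls).
    by have [_] := s_min l ls; apply=> //; case: minQ.
  - by move=> ks _ _; apply: Q_anti.
  - by move=> ks ls; rewrite eqSS; apply: s_anti.
have /choice[x hx] (k : 'I_(size s)) : exists x, nth set0 s k x /\ ~ n x.
  have [[_ + _]] := s_min k (ltn_ord k).
  by move=> /existsNP[x /not_implyP[]]; exists x.
have Rx k : R (x k).
  have [[sp _] _] := s_min k (ltn_ord k); apply: prime_sub sp _ _.
  by case: (hx k).
exists (\prod_(k <- enum 'I_(size s)) x k); split.
- exact: set_ring_prod.
- by move=> /(prime_prod R_subring n_prime)[k _|k _]; [exact: Rx|case: (hx k)].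
- move=> P Pp Pn; have [Q minQ QP] := minS_ex P (conj Pp Pn).
  have [k ks kQ] := s_all Q minQ; apply/QP/kQ.
  have [[sp _] _] := s_min k ks.
  apply: (prime_prod_mem R_subring sp (l := Ordinal ks)) => //.
    by rewrite mem_enum.
  by case: (hx (Ordinal ks)).
Qed.

End PrimesOverValuationRing.

(** * The extension generated by eta *)

Section Adjoin.
Variables (R : comNzRingType) (A X : set R).

Lemma adjoin_subring : subring_closed (mem (adjoin A X)).
Proof.
split=> [|x y|x y].
- by rewrite inE => S [[S1 _ _] _]; rewrite inE in S1.
- rewrite !inE => Ax Ay S SX; have [[_ SB _] _] := SX.
  by have := SB x y; rewrite !inE; apply; [exact: Ax|exact: Ay].
- rewrite !inE => Ax Ay S SX; have [[_ _ SM] _] := SX.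
  by have := SM x y; rewrite !inE; apply; [exact: Ax|exact: Ay].
Qed.

Lemma sub_adjoinl : A `<=` adjoin A X.
Proof. by move=> x Ax S [_]; apply; left. Qed.

Lemma sub_adjoinr : X `<=` adjoin A X.
Proof. by move=> x Xx S [_]; apply; right. Qed.

Lemma adjoin_smallest S : subring_closed (mem S) -> A `<=` S -> X `<=` S ->
  adjoin A X `<=` S.
Proof. by move=> S_ring AS XS x; apply; split=> // y [/AS|/XS]. Qed.

End Adjoin.

Lemma units_ofP (K : fieldType) (v : valuation K) x :
  units_of (valuation_ring v) x <-> x \in vring v /\ x \notin videal v.
Proof.
split=> [[Ox [y Oy xy]]|[Ox /(vunitP Ox)[x0 xV]]].
  have xO : x \in vring v by apply/asboolP.
  split=> //; apply/vunitP => //.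
  have x0 : x != 0.
    by apply/eqP => x0; move: xy; rewrite x0 mul0r => /esym/eqP; rewrite oner_eq0.
  by split=> //; rewrite -[x^-1]mulr1 -xy mulKf //; apply/asboolP.
by split; [exact/asboolP|exists x^-1; [exact/asboolP|exact: divff]].
Qed.

Lemma vring_set_subring (K : fieldType) (v : valuation K) :
  subring_closed (mem (valuation_ring v)).
Proof.
have e x : (x \in mem (valuation_ring v)) = (x \in vring v).
  by apply/idP/asboolP; rewrite inE.
split=> [|x y|x y]; rewrite !e; [exact: rpred1|exact: rpredB|exact: rpredM].
Qed.

(** The reciprocal polynomial g(X) = X^d f(1/X) vanishes at 1/x, and since f(x) = 0 its derivative
    satisfies x^d g'(1/x) = - x^2 f'(x), a unit. *)
Lemma henselian_inv (L : fieldType) (F : fieldExtType L) (v : valuation F)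
    (f : {poly F}) (x : F) :
  (forall k, base_valuation_ring v f`_k) -> f.[x] = 0 ->
  units_of (valuation_ring v) x -> units_of (valuation_ring v) f^`().[x] ->
  henselian (base_valuation_ring v) (valuation_ring v) x^-1.
Proof.
move=> fO fx /units_ofP[xO xu] /units_ofP[dO du].
have x0 := vunit_neq0 xu; have xVO := vunitV xO xu.
pose d := (size f).-1.
pose g := \sum_(l < size f) f`_l *: 'X^(d - l) : {poly F}.
have le_d (l : 'I_(size f)) : (l <= d)%N by rewrite -ltnS (leq_trans (ltn_ord l)) // leqSpred.
have fE : f = \sum_(l < size f) f`_l *: 'X^l by rewrite -{1}[f]coefK poly_def.
have gO k : base_valuation_ring v g`_k.
  have fO' l : f`_l \in vring v by apply/asboolP; case: (fO l).
  have fO1 l : f`_l \in 1%VS by case: (fO l).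
  split.
    apply/(asboolP (valuation_ring v _)); rewrite -[asbool _]/(_ \in vring v).
    rewrite coef_sum; apply: rpred_sum => l _; rewrite coefZ coefXn.
    by rewrite rpredM // rpred_nat.
  rewrite /= coef_sum; apply: rpred_sum => l _; rewrite coefZ coefXn mulr_natr.
  exact: rpredMn.
split; first exact/asboolP.
exists g; split=> //.
  apply: (mulfI (expf_neq0 d x0)); rewrite mulr0 -fx [in RHS]fE !horner_sum mulr_sumr.
  apply: eq_bigr => l _; rewrite !hornerZ !hornerXn mulrCA exprVn; congr (_ * _).
  by rewrite -{1}(subnK (le_d l)) exprD mulrAC divff ?mul1r // expf_neq0.
have dgE : x ^+ d * g^`().[x^-1] = - (x ^+ 2 * f^`().[x]).
  have dfE : x * f^`().[x] = \sum_(l < size f) f`_l * x ^+ l *+ l.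
    rewrite [in LHS]fE raddf_sum horner_sum mulr_sumr; apply: eq_bigr => l _.
    rewrite /= derivZ derivXn hornerZ hornerMn hornerXn mulrCA -mulrnAr; congr (_ * _).
    by case: (l : nat) => [|k]; rewrite ?mulr0n ?mulr0 // mulrnAr -exprS.
  have -> : - (x ^+ 2 * f^`().[x]) = x * (f.[x] *+ d - x * f^`().[x]).
    by rewrite fx mul0rn sub0r mulrN mulrA expr2.
  rewrite dfE [in f.[x]]fE horner_sum -sumrMnl -sumrB mulr_sumr.
  rewrite /g raddf_sum horner_sum mulr_sumr; apply: eq_bigr => l _.
  rewrite /= derivZ derivXn !hornerZ hornerMn !hornerXn -mulrnBr ?le_d //.
  rewrite mulrCA -!mulrnAr [in RHS]mulrCA; congr (_ * _); rewrite !mulrnAr.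
  (* The term l = d carries the factor d - l = 0; below it, the exponent d - l - 1 is a genuine
     difference. *)
  have := le_d l; rewrite leq_eqVlt => /predU1P[->|ld]; first by rewrite subnn !mulr0n.
  congr (_ *+ _); rewrite -exprS exprVn -subn1 -subnDA addn1.
  by rewrite -{1}(subnK ld) exprD mulrAC divff ?mul1r // expf_neq0.
have dgO : g^`().[x^-1] \in vring v.
  apply: vring_horner => //; apply: polyOver_deriv; apply/polyOverP => k.
  by apply/asboolP; case: (gO k).
apply/units_ofP; split=> //; apply: contra (_ : x ^+ 2 * f^`().[x] \notin videal v).
  by move=> dgm; rewrite -rpredN -dgE videalMl // rpredX.
by rewrite vunitM ?rpredX // vunitX.
Qed.

(** * Passage between [F] and the conjugates of [eta] in [M] *)

Section Inertial.
Variables (L : fieldType) (F : fieldExtType L) (v : valuation F).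
Variables (M : fieldType) (j : {rmorphism F -> M}) (w : valuation M).
Hypothesis vw : extends_valuation j v w.

Lemma vring_extends x : (j x \in vring w) = (x \in vring v).
Proof.
case: vw => phi [phi_mono phiE]; have [->|x0] := eqVneq x 0.
  by rewrite rmorph0 !rpred0.
have e : (0 <= w (j x)) = (0 <= v x).
  by rewrite phiE // -[X in X <= _](raddf0 phi) phi_mono.
apply/vringP/vringP => -[/eqP|]; rewrite ?fmorph_eq0 ?(negPf x0) // ?e.
  by right.
by right.
Qed.

Lemma videal_extends x : (j x \in videal w) = (x \in videal v).
Proof.
apply/idP/idP => h; apply/negPn/negP.
  have xO : x \in vring v by rewrite -vring_extends; exact: videal_vring.
  move/(vunitP xO) => [x0 xV]; have /vunitP[] : j x \in vring w by rewrite vring_extends.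
  by move=> _ /(_ _)/negP; apply=> //; rewrite fmorph_eq0 -fmorphV vring_extends.
have xO := videal_vring h.
have jxO : j x \in vring w by rewrite vring_extends.
move/(vunitP jxO); rewrite fmorph_eq0 -fmorphV vring_extends.
by move/(vunitP xO); rewrite h.
Qed.

Variable eta : F.
Let i : {rmorphism L -> M} := j \o in_alg F.
Local Notation "p ^i" := (map_poly i p) (at level 2, format "p ^i").
Local Notation "p ^a" := (map_poly (in_alg F) p) (at level 2, format "p ^a").

Lemma map_poly_through (p : {poly L}) : p^i = map_poly j p^a.
Proof. by rewrite /i map_poly_comp. Qed.

Lemma horner_through (p : {poly L}) x : p^i.[j x] = j p^a.[x].
Proof. by rewrite map_poly_through horner_map. Qed.

Local Notation OL := (base_valuation_ring v).

Lemma base_vringE (a : L) : OL a%:A <-> i a \in vring w.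
Proof.
rewrite [i a]/(j a%:A) vring_extends; split=> [[/asboolP//]|].
exact: base_vring.
Qed.

(** Gives elements of [R] a form that can be evaluated at every conjugate, with integrality of
    coefficients read in [M]. *)
Lemma adjoin_etaP x : adjoin OL [set eta] x <->
  exists2 P : {poly L}, P^i \is a polyOver (vring w) & x = P^a.[eta].
Proof.
split=> [|[P PO ->]].
  apply: (_ : adjoin OL [set eta] `<=` [set x | exists2 P : {poly L},
    P^i \is a polyOver (vring w) & x = P^a.[eta]]); apply: adjoin_smallest.
  - split=> [|_ _ /set_mem[P PO ->] /set_mem[Q QO ->]|
      _ _ /set_mem[P PO ->] /set_mem[Q QO ->]]; apply/mem_set.
    + by exists 1; rewrite rmorph1 ?rpred1 ?hornerC.
    + by exists (P - Q); rewrite rmorphB ?hornerD ?hornerN //; exact: rpredB.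
    + by exists (P * Q); rewrite rmorphM ?hornerM //; exact: rpredM.
  - move=> y [yO /vlineP[a ya]]; exists a%:P; last by rewrite map_polyC hornerC.
    rewrite map_polyC polyOverC; apply/base_vringE; rewrite -ya; split=> //.
    by rewrite ya; apply: rpredZ; exact: rpred1.
  - by move=> y ->; exists 'X; rewrite map_polyX ?hornerX ?polyOverX.
have R_ring := @adjoin_subring _ OL [set eta].
rewrite horner_coef; apply: (big_ind (adjoin OL [set eta])) => [||k _].
- exact: set_ring0.
- exact: set_ringD.
apply: (set_ringM R_ring); last by apply: (set_ringX R_ring); exact: sub_adjoinr.
rewrite coef_map; apply: sub_adjoinl; apply/base_vringE.
by have := polyOverP PO k; rewrite coef_map.
Qed.

Variables (h : {poly L}) (rs : seq M).
Hypotheses (h_fact : h^i = \prod_(r <- rs) ('X - r%:P)) (rs_uniq : uniq rs).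
Hypothesis hO : h^i \is a polyOver (vring w).
Hypothesis h_eta : root h^a eta.
Hypotheses (eta_gen : forall x, exists Q : {poly L}, x = Q^a.[eta]).
Hypotheses (etaO : eta \in vring v) (eta_u : eta \notin videal v).
Hypothesis h'_eta : h^a^`().[eta] \notin videal v.

Local Notation R := (adjoin OL [set eta]).
Local Notation n := (valuation_ideal v `&` R).

Let r0_rs : j eta \in rs.
Proof.
by rewrite -root_prod_XsubC -h_fact /root horner_through fmorph_eq0.
Qed.

Let rsO : {in rs, forall r, r \in vring w}.
Proof.
move=> r; rewrite -root_prod_XsubC -h_fact; apply: vring_integral => //.
by rewrite h_fact monic_prod_XsubC.
Qed.

Let h'r0 : h^i^`().[j eta] \notin videal w.
Proof. by rewrite map_poly_through deriv_map horner_map videal_extends. Qed.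

(** The substantial inclusion in the identification of O_F with the localization of [R] at its
    centre. *)
Lemma vring_fraction y : y \in vring v ->
  exists a b, [/\ R a, R b, b \notin videal v & y * b = a].
Proof.
have [Q ->] := eta_gen y; rewrite -vring_extends -horner_through => yO.
have [B [C [BO CO Bu BC]]] := vring_quotient h_fact rs_uniq r0_rs rsO h'r0 yO.
exists C^a.[eta], B^a.[eta]; split.
- by apply/adjoin_etaP; exists C.
- by apply/adjoin_etaP; exists B.
- by rewrite -videal_extends -horner_through.
- by apply: (fmorph_inj j); rewrite rmorphM /= -!horner_through.
Qed.

(** The equation is the characteristic polynomial, integral because its roots are values of an
    integral polynomial at integral conjugates. *)
Lemma adjoin_eta_integral x : R x -> exists f : {poly L},
  [/\ f \is monic, forall k, (f`_k)%:A \in vring v & f^a.[x] = 0].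
Proof.
move=> /adjoin_etaP[P PO ->].
have [f f1 f_fact] := conjugates_poly P h_fact rs_uniq.
exists f; split=> // [k|].
  have fO : f^i \is a polyOver (vring w).
    rewrite f_fact big_seq; apply: rpred_prod => r rrs.
    by rewrite polyOverXsubC; apply: vring_horner (rsO rrs).
  by have := polyOverP fO k; rewrite coef_map -vring_extends.
apply: (fmorph_inj j); rewrite -horner_through -horner_through rmorph0.
apply/rootP; rewrite f_fact.
by rewrite -(big_map (fun r => P^i.[r]) xpredT (fun x => 'X - x%:P))
  root_prod_XsubC map_f.
Qed.

Lemma adjoin_eta_vring x : R x -> x \in vring v.
Proof.
move=> /adjoin_etaP[P PO ->]; rewrite -vring_extends -horner_through.
by apply: vring_horner; rewrite ?vring_extends.
Qed.

Lemma adjoin_eta_subring : subring_closed (mem R).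
Proof. exact: adjoin_subring. Qed.

Lemma not_center x : R x -> ~ n x <-> x \notin videal v.
Proof.
move=> Rx; split=> [nx|/negP xu [] /asboolP //].
by apply/negP => xm; apply: nx; split=> //; apply/asboolP.
Qed.

Lemma center_prime : prime_ideal R n.
Proof.
have R_ring := adjoin_eta_subring; split.
- by move=> x [].
- split; first by split; [left|exact: set_ring0].
  move=> a x y Ra [/asboolP xm Rx] [/asboolP ym Ry]; split.
    apply/(asboolP (valuation_ideal v _)); rewrite -[asbool _]/(_ \in videal v).
    by apply: rpredD => //; apply: videalMl => //; exact: adjoin_eta_vring.
  by apply: (set_ringD R_ring) => //; exact: (set_ringM R_ring).
- by move/not_center: (set_ring1 R_ring) => [_]; apply; exact: videalN1.
- move=> x y Rx Ry nxy; apply: contrapT => /not_orP[/(not_center Rx) xu].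
  move=> /(not_center Ry) yu.
  have Rxy := set_ringM R_ring Rx Ry; move: nxy; apply/(not_center Rxy).
  by rewrite vunitM ?xu //; exact: adjoin_eta_vring.
Qed.

(** Descends [henselian_multiple] to [F], then passes to the inverse, the element to be adjoined in
    (iii). *)
Lemma henselian_unit u : R u -> u \notin videal v ->
  exists t, [/\ R t, t * u \notin videal v & henselian OL (valuation_ring v) (t * u)^-1].
Proof.
move=> /adjoin_etaP[U UO ->] Uu.
have [|||V [f [VO fO VUu f0 f'u]]] :=
  @henselian_multiple _ _ i w h rs (j eta) h_fact rs_uniq r0_rs rsO h'r0 U.
- by rewrite videal_extends.
- exact: UO.
- by rewrite horner_through videal_extends.
have VUE : j (V^a.[eta] * U^a.[eta]) = (V * U)^i.[j eta].
  by rewrite rmorphM !rmorphM hornerM /= -!horner_through.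
exists V^a.[eta]; set x := _ * U^a.[eta] in VUE *.
have Rx : R x.
  by apply: (set_ringM adjoin_eta_subring); apply/adjoin_etaP; [exists V|exists U].
have xO := adjoin_eta_vring Rx.
split; first by apply/adjoin_etaP; exists V.
  by rewrite -videal_extends VUE.
have fL k : OL (f^a)`_k.
  rewrite coef_map; apply/base_vringE.
  by have := polyOverP fO k; rewrite coef_map.
apply: (henselian_inv fL).
- by apply: (fmorph_inj j); rewrite -horner_through VUE f0 rmorph0.
- by apply/units_ofP; rewrite xO -videal_extends VUE.
apply/units_ofP; split.
  apply: vring_horner xO; apply: polyOver_deriv; apply/polyOverP => k.
  by apply/asboolP; case: (fL k).
by rewrite -videal_extends -horner_map -deriv_map -map_poly_through VUE.
Qed.

(** Let y = a / b with [b] outside the centre. A prime containing [b] is not below the centre, so it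
    contains [u]; hence u^k = b c with c in [R], and y = a c / u^k. *)
Lemma vring_localization u : R u -> u \notin videal v ->
  (forall P, prime_ideal R P -> ~ (P `<=` n) -> P u) ->
  valuation_ring v = adjoin OL [set eta; u^-1].
Proof.
move=> Ru uu uP; have R_ring := adjoin_eta_subring.
have S_ring := @adjoin_subring _ OL [set eta; u^-1].
apply/seteqP; split=> y.
  move=> /asboolP /vring_fraction[a [b [Ra Rb bu yb]]].
  have [|k [c [Rc uk]]] := prime_radical R_ring Rb Ru.
    move=> P Pp Pb; apply: uP => // /(_ _ Pb); exact/not_center.
  have RS : R `<=` adjoin OL [set eta; u^-1].
    apply: adjoin_smallest => // [|_ ->]; first exact: sub_adjoinl.
    by apply: sub_adjoinr; left.
  have -> : y = (a * c) * u^-1 ^+ k.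
    rewrite exprVn -yb -(mulrA y) -uk mulfK // expf_neq0 //; exact: vunit_neq0 uu.
  apply: (set_ringM S_ring); first by apply: RS; apply: (set_ringM R_ring).
  by apply: (set_ringX S_ring); apply: sub_adjoinr; right.
apply: adjoin_smallest => [|x []//|x [->|->]]; first exact: vring_set_subring.
  exact/asboolP.
by apply/(asboolP (valuation_ring v _)); apply: vunitV => //; exact: adjoin_eta_vring.
Qed.

End Inertial.

(** * Splitting of the minimal polynomial and the five conditions *)

Lemma separably_closed_splits (M : fieldType) (q : {poly M}) :
  (forall q : {poly M}, separable_poly q -> (1 < size q)%N -> exists x, root q x) ->
  q \is monic -> separable_poly q -> exists rs, q = \prod_(r <- rs) ('X - r%:P).
Proof.
move=> Mclosed; have [m] := ubnP (size q); elim: m q => // m IHm q szq q1 q_sep.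
have [q_big|q_small] := ltnP 1 (size q); last first.
  exists [::]; rewrite big_nil (size1_polyC q_small).
  have := monicP q1; rewrite lead_coefE.
  have -> : (size q).-1 = 0 by case: (size q) q_small => [|[]].
  by move=> ->.
have [x /factor_theorem[p qE]] := Mclosed q q_sep q_big.
have p1 : p \is monic by rewrite -(monicMr _ (monicXsubC x)) -qE.
have [|//||rs pE] := IHm p.
- rewrite -ltnS; apply: leq_trans szq.
  by rewrite qE size_Mmonic ?monicXsubC ?monic_neq0 // size_XsubC addn2.
- by apply: dvdp_separable q_sep; rewrite qE dvdp_mulr.
- by exists (x :: rs); rewrite big_cons -pE mulrC.
Qed.

Theorem theorem1p7 (L : fieldType) (F : fieldExtType L) (v : valuation F)
    (eta : F) :
  let OF := valuation_ring v in
  let OL := base_valuation_ring v in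
  let h := minPoly 1%VS eta in
  let OLeta := adjoin OL [set eta] in
  let n := valuation_ideal v `&` OLeta in
  inertial v ->
  wo_chain (fun P Q : set F => `[< P `<=` Q >])
    (mem [set P : set F | prime_ideal OL P]) ->
  OF eta ->
  <<1; eta>>%VS = fullv ->
  (forall k, OL h`_k) ->
  units_of OF eta ->
  units_of OF h^`().[eta] ->
  [/\ (* (i) *)
      finitely_generated_algebra OL OF,
      (* (ii) *)
      exists u : F, [/\ units_of OF u, OLeta u &
        OF = adjoin OL [set eta; u^-1]],
      (* (iii) *)
      exists r s : F, [/\ henselian OL OF r, henselian OL OF s &
        OF = adjoin OL [set eta; r; s]],
      (* (iv) *)
      exists u : F, (OLeta `\` n) u /\
        forall P : set F, prime_ideal OLeta P -> ~ (P `<=` n) -> P u &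
      (* (v) *)
      forall (I : Type) (p : I -> set F),
        (forall k, prime_ideal OLeta (p k)) ->
        total_on (range p) subset ->
        (forall k, ~ (p k `<=` n)) ->
        ~ (OLeta `&` \bigcap_k p k `<=` n)].

Proof.
move=> OF OL h OLeta n [M [j [w [[_ Mclosed] vw _]]]] OL_wo /asboolP etaO Fgen hOL.
move=> /units_ofP[_ eta_u] /units_ofP[_ h'_eta].
pose i : {rmorphism L -> M} := j \o in_alg F.
have /polyOver1P[h0 hE] : h \is a polyOver 1%VS by exact: minPolyOver.
(* A minimal polynomial with nonzero derivative is separable, and h' is nonzero because h'(eta) is a
   unit. *)
have h_sep : separable_poly h.
  rewrite -[separable_poly h]/(separable_element 1 eta) separable_nz_der.
  by apply: contraNneq h'_eta => ->; rewrite horner0 videal0.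
have hiE : map_poly i h0 = map_poly j h by rewrite hE -map_poly_comp.
have [||rs h_fact] := @separably_closed_splits M (map_poly i h0) Mclosed.
- by rewrite hiE map_monic monic_minPoly.
- by rewrite hiE separable_map.
have rs_uniq : uniq rs by rewrite -separable_prod_XsubC -h_fact hiE separable_map.
have hO : map_poly i h0 \is a polyOver (vring w).
  apply/polyOverP=> k; rewrite hiE coef_map (vring_extends vw).
  by apply/asboolP; case: (hOL k).
have h_eta : root (map_poly (in_alg F) h0) eta by rewrite -hE root_minPoly.
have eta_gen x : exists Q : {poly L}, x = (map_poly (in_alg F) Q).[eta].
  have /Fadjoin_polyP[p /polyOver1P[Q ->] ->] : x \in <<1; eta>>%VS by rewrite Fgen memvf.
  by exists Q.
rewrite hE in h'_eta.
have R_ring : subring_closed (mem OLeta) := @adjoin_subring _ OL [set eta].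
have OL_R : OL `<=` OLeta by exact: sub_adjoinl.
have R_int := adjoin_eta_integral vw h_fact rs_uniq hO h_eta.
have RO := adjoin_eta_vring vw etaO.
have n_prime := center_prime vw etaO.
have [u [Ru nu u_all]] := element_of_primes_not_below R_ring OL_R R_int OL_wo n_prime.
have uu : u \notin videal v by apply/(not_center Ru).
have localization := vring_localization vw h_fact rs_uniq hO h_eta eta_gen etaO h'_eta.
have OFu := localization u Ru uu u_all.
split.
- exists [:: eta; u^-1]; rewrite {1}/OF OFu; congr (adjoin _ _).
  apply/seteqP; split=> x /=; rewrite !inE; first by move=> [->|->]; rewrite eqxx ?orbT.
  by move=> /orP[]/eqP->; [left|right].
- by exists u; split=> //; apply/units_ofP; split=> //; exact: RO.
(* The multiple [t * u] is still a unit and lies in every prime required to contain [u], so its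
   inverse generates O_F over [OLeta] as well; it serves as both r and s. *)
- have [t [Rt tu tu_hens]] := henselian_unit vw h_fact rs_uniq hO h_eta etaO eta_u h'_eta Ru uu.
  exists (t * u)^-1, (t * u)^-1; split=> //.
  rewrite -setUA setUid; apply: localization => //; first exact: (set_ringM R_ring).
  by move=> P Pp Pn; apply: (primeMl Pp Rt); exact: u_all.
- by exists u.
(* The element [u] of (iv) lies in every member of the family, hence in the intersection, also for
   an empty index type, but not in [n]. *)
- move=> I p p_prime _ p_n /(_ u) sub; apply: nu; apply: sub.
  by split=> // k _; exact: u_all.
Qed.
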